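(* Let $G=(V,E)$ be a directed influence graph in which every edge has strictly positive influence probability, and let the agent $L\in V$ (the leader) hold the abstract being $X$ with representation $X_L\in\mathcal{V}_L$. Let $\mathcal{C}_L(X_L)$ be the leadership component of $L$. Under the repeated independent influence process: (1) If $i\in\mathcal{C}_L(X_L)$, then with probability $1$, $i$ eventually adopts a nonzero representation $X_i\in\mathcal{V}_i$ of $X$ consistent with $X_L$. (2) If $i\notin\mathcal{C}_L(X_L)$, then $i$ can never adopt any nonzero representation consistent with $X_L$. (3) $L$ fully leads the group with respect to $X_L$ if and only if $\mathcal{C}_L(X_L)=V$.
   Context: Each agent $i\in V$ has a value space $\mathcal{V}_i$, a finite-dimensional real vector space; an abstract being $X$ is represented in agent $i$ by a vector $X_i\in\mathcal{V}_i$. For each edge $(i,j)\in E$ there is a linear interpretation map $T_{i\to j}:\mathcal{V}_i\to\mathcal{V}_j$ and an influence probability $\mathrm{infl}(i\to j)\in(0,1]$. Composite interpretation map: for a directed path $L=v_0\to v_1\to\cdots\to v_k=i$ in $G$, $T_{L\rightsquigarrow i}=T_{v_{k-1}\to v_k}\circ\cdots\circ T_{v_0\to v_1}$ (the identity for the trivial path, $k=0$). $\mathrm{Null}(T)$ denotes the null space (kernel) of $T$. Leadership component: $\mathcal{C}_L(X_L)=\{i\in V:\text{ there is a directed path } L\rightsquigarrow i \text{ with } X_L\notin\mathrm{Null}(T_{L\rightsquigarrow i})\}$. Repeated independent influence process: time is discrete; at each time step, agents holding $X$ attempt to influence their out-neighbors; each attempt along an edge $(i,j)$ succeeds, independently,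 with probability $\mathrm{infl}(i\to j)$; failed attempts are repeated at later steps. Representations are transmitted along paths: when influence has succeeded successively along all edges of a directed path $L\rightsquigarrow i$, agent $i$ receives (adopts) the vector $T_{L\rightsquigarrow i}(X_L)$. A representation of $X$ in agent $i$ is consistent with $X_L$ if it is of the form $T_{L\rightsquigarrow i}(X_L)$ for a directed path $L\rightsquigarrow i$ along which it was transmitted. $L$ fully leads the group with respect to $X_L$ means that every agent of $V$ belongs to the leadership component of $L$ for $X_L$. *)

(* Defs.v *)
From HB Require Import structures.
From mathcomp Require Import all_boot all_order all_algebra.
From mathcomp Require Import finmap.
From mathcomp Require Import all_classical all_reals all_analysis.

Set Implicit Arguments.
Unset Strict Implicit.
Unset Printing Implicit Defensive.

Import Order.TTheory GRing.Theory Num.Theory.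

Local Open Scope classical_set_scope.
Local Open Scope ring_scope.

Section Paths.
Context {V : Type} (E : rel V).

(* Vertices may be repeated. *)
Inductive dipath (L : V) : V -> Type :=
| dipath_nil : dipath L L
| dipath_rcons (i j : V) : dipath L i -> E i j -> dipath L j.

Context {R : realType} {S : V -> vectType R}.

(* T is total for convenience: its values off E are never used. *)
Fixpoint interp (T : forall i j : V, 'Hom(S i, S j)) (L i : V)
    (p : dipath L i) : 'Hom(S L, S i) :=
  match p in dipath _ k return 'Hom(S L, S k) with
  | dipath_nil => \1%VF
  | dipath_rcons i j q _ => (T i j \o interp T q)%VF
  end.

Definition leadership_component (T : forall i j : V, 'Hom(S i, S j))
    (L : V) (XL : S L) : set V :=
  [set i | exists p : dipath L i, XL \notin lker (interp T p)].

Definition fully_leads (T : forall i j : V, 'Hom(S i, S j))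
    (L : V) (XL : S L) : Prop :=
  forall i : V, leadership_component T XL i.

End Paths.

Section Process.
Context {d : measure_display} {Omega : measurableType d} {R : realType}
  (P : probability Omega R).

Definition mutually_independent (I : choiceType) (D : set I)
    (A : I -> set Omega) : Prop :=
  forall F : {fset I}, [set` F] `<=` D ->
    P (\bigcap_(k in [set` F]) A k) = (\prod_(k <- F) P (A k))%E.

Context {V : choiceType} (E : rel V).

(* [success s i j] is the event that an attempt made at step s along the edge
   (i, j) succeeds. As usual the family is indexed by all steps and edges; the
   outcome is only consulted when i holds a representation at step s (see
   [transmitted]). Nothing is required of [infl] and [success] off E. *)
Definition independent_influence (infl : V -> V -> R)
    (success : nat -> V -> V -> set Omega) : Prop :=
  [/\ forall s i j, E i j -> measurable (success s i j),
      forall s i j, E i j -> P (success s i j) = (infl i j)%:E &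
      mutually_independent [set k : nat * V * V | E k.1.2 k.2]
        (fun k => success k.1.1 k.1.2 k.2)].

Variable success : nat -> V -> V -> set Omega.

(* In outcome w, influence has succeeded successively along all the edges of p
   before step t. The leader holds X from step 0 on; an agent reached through q
   by step s may transmit along an outgoing edge at step s, and the receiver
   then holds the result from step s + 1 on. Attempts continue at every step,
   so requiring some success after q is transmitted amounts to repeating failed
   attempts until the first success. *)
Fixpoint transmitted (w : Omega) (t : nat) (L i : V) (p : dipath E L i) :
    Prop :=
  match p with
  | dipath_nil => True
  | dipath_rcons i j q _ =>
      exists s : nat, [/\ (s < t)%N, transmitted w s q & success s i j w]
  end.

Context {S : V -> vectType R} (T : forall i j : V, 'Hom(S i, S j)).

(* An agent may receive several representations, through different paths. *)
Definition adopts (L : V) (XL : S L) (w : Omega) (t : nat) (i : V)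
    (x : S i) : Prop :=
  exists p : dipath E L i, transmitted w t p /\ x = interp T p XL.

Definition consistent (L : V) (XL : S L) (w : Omega) (i : V) (x : S i) :
    Prop :=
  exists p : dipath E L i,
    (exists t : nat, transmitted w t p) /\ x = interp T p XL.

End Process.

(* Main.v *)
Require Import Defs.
From HB Require Import structures.
From mathcomp Require Import all_boot all_order all_algebra.
From mathcomp Require Import finmap.
From mathcomp Require Import all_classical all_reals all_analysis.

Set Implicit Arguments.
Unset Strict Implicit.
Unset Printing Implicit Defensive.

Import Order.TTheory GRing.Theory Num.Theory.

Local Open Scope classical_set_scope.
Local Open Scope ring_scope.

(* Since every path is finite, statement (1) reduces to the claim that each edge
   succeeds infinitely often almost surely: the edges of a path can then be
   crossed one after the other. Mutual independence is only given for the
   success events, so the probability (1 - q)^n of n failures on an edge is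
   obtained by induction on n, jointly with a finite set of further successes,
   from P(X \ A) = P(X) - P(X & A). *)

Section IndependentEvents.
Context {d : measure_display} {Omega : measurableType d} {R : realType}
  (P : probability Omega R) {I : choiceType} (D : set I) (A : I -> set Omega).
Hypothesis measurableA : forall i, D i -> measurable (A i).
Hypothesis indepA : mutually_independent P D A.

Lemma mutually_independent_fsetU1 (x : I) (F : {fset I}) :
  D x -> [set` F] `<=` D -> x \notin F ->
  P (\bigcap_(k in [set` (x |` F)%fset]) A k) =
  (P (A x) * P (\bigcap_(k in [set` F]) A k))%E.
Proof.
move=> Dx FD xF; rewrite !indepA// ?big_fsetU1//.
by move=> i /=; rewrite in_fset1U => /orP[/eqP->|/FD].
Qed.

Variables (k : nat -> I) (q : R).
Hypotheses (k_inj : injective k) (Dk : forall n, D (k n)).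
Hypothesis PAk : forall n, P (A (k n)) = q%:E.

(** Letting [F] vary is what makes the induction close: peeling off the failure of [k n] produces a
    term in which [k n] succeeds instead. The condition on [F] prevents an event from being required
    both to fail and to succeed. *)
Lemma probability_failures_successes (n : nat) (F : {fset I}) :
  [set` F] `<=` D -> (forall m, (m < n)%N -> k m \notin F) ->
  P (\bigcap_(m < n) ~` A (k m) `&` \bigcap_(i in [set` F]) A i) =
  (((1 - q) ^+ n)%:E * P (\bigcap_(i in [set` F]) A i))%E.
Proof.
have mF (G : {fset I}) : [set` G] `<=` D ->
    measurable (\bigcap_(i in [set` G]) A i).
  by move=> GD; apply: fin_bigcap_measurable => // i /GD; exact: measurableA.
elim: n F => [|n IHn] F FD kF.
  by rewrite bigcap_mkord big_ord0 setTI expr0 mul1e.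
have kFn : k n \notin F by exact: kF.
have kF' m : (m < n)%N -> k m \notin F by move=> mn; apply: kF; exact: ltnW.
have UD : [set` (k n |` F)%fset] `<=` D.
  by move=> i /=; rewrite in_fset1U => /orP[/eqP->|/FD].
have kU m : (m < n)%N -> k m \notin (k n |` F)%fset.
  move=> mn; rewrite in_fset1U negb_or kF'// andbT.
  by apply/eqP => /k_inj mE; rewrite mE ltnn in mn.
set X := \bigcap_(m < n) ~` A (k m) `&` \bigcap_(i in [set` F]) A i.
have -> : \bigcap_(m < n.+1) ~` A (k m) `&` \bigcap_(i in [set` F]) A i =
    X `\` A (k n).
  by rewrite !bigcap_mkord big_ord_recr/= /X bigcap_mkord setDE setIAC.
have mX : measurable X.
  apply: measurableI; last exact: mF.
  by apply: bigcap_measurableType => m _; apply/measurableC/measurableA/Dk.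
have -> : P (X `\` A (k n)) = (P X - P (X `&` A (k n)))%E.
  apply: measureD => //; first exact/measurableA/Dk.
  by rewrite (le_lt_trans (probability_le1 _ _)) ?ltry.
(* The success of [k n] is absorbed into the finite set, so the induction hypothesis covers this
   term too. *)
have -> : X `&` A (k n) = \bigcap_(m < n) ~` A (k m) `&`
    \bigcap_(i in [set` (k n |` F)%fset]) A i.
  by rewrite bigcap_fsetU1 /X -setIA [A (k n) `&` _]setIC.
rewrite IHn// IHn// mutually_independent_fsetU1// PAk.
(* With [p] the finite probability of the successes in [F], what remains is the real identity
   $(1-q)^n p - (1-q)^n q p = (1-q)^{n+1} p$. *)
have /fineK <- := fin_num_measure P _ (mF _ FD).
rewrite -!EFinM -EFinB; congr EFin.
by rewrite exprSr mulrBr mulr1 mulrBl mulrA.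
Qed.

(** Permanent failure implies failure in the first [n] trials, for every [n], and $(1-q)^n$ tends to
    0 because [q] is positive. *)
Lemma ae_exists_success : 0 < q <= 1 ->
  {ae P, forall w, exists n, A (k n) w}.
Proof.
move=> /andP[q0 q1].
have mC n : measurable (~` A (k n)) by exact/measurableC/measurableA/Dk.
have mN : measurable (\bigcap_n ~` A (k n)).
  exact: bigcap_measurableType.
have PN0 : P (\bigcap_n ~` A (k n)) = 0%E.
  apply/eqP; rewrite eq_le measure_ge0 andbT.
  have PN n : (P (\bigcap_n ~` A (k n)) <= ((1 - q) ^+ n)%:E)%E.
    have := @probability_failures_successes n fset0.
    rewrite set_fset0 bigcap_set0 setIT probability_setT mule1.
    move=> <- //; apply: le_measure; rewrite ?inE//.
      exact: bigcap_measurableType.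
    by move=> w wN m _; exact: wN.
  have q1' : `|1 - q| < 1 by rewrite ger0_norm ?subr_ge0// ltrBlDr ltrDl.
  move: PN; have /fineK <- := fin_num_measure P _ mN => PN; rewrite lee_fin.
  apply: (cvgr_to_ge (cvg_geometric 1 q1')); apply: nearW => n.
  by rewrite /geometric/= mul1r -lee_fin.
apply: (negligibleS _ ((negligibleP _ mN).2 PN0)) => w /= wN n _ Anw.
by apply: wN; exists n.
Qed.

End IndependentEvents.

Section Transmission.
Context {d : measure_display} {Omega : measurableType d} {R : realType}
  (P : probability Omega R) {V : choiceType} (E : rel V)
  (success : nat -> V -> V -> set Omega).

Lemma transmitted_monotone (L i : V) (p : dipath E L i) (w : Omega)
    (s t : nat) : (s <= t)%N ->
  transmitted success w s p -> transmitted success w t p.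
Proof.
(* The deadline bounds only the crossing of the last edge, so a case analysis replaces induction. *)
case: p => //= j l q Ejl st [r [rs trq rw]].
by exists r; split => //; exact: leq_trans st.
Qed.

Variable infl : V -> V -> R.
Hypothesis infl_gt0_le1 : forall i j, E i j -> 0 < infl i j <= 1.
Hypothesis influence_process : independent_influence P E infl success.

(** The bound [m] is quantified inside the almost sure event, so that it may later depend on the
    outcome; this costs only a countable intersection. For fixed [m], the trials are those from step
    [m] on. *)
Lemma ae_infinitely_many_successes (i j : V) : E i j ->
  {ae P, forall w m, exists s, (m <= s)%N /\ success s i j w}.
Proof.
case: influence_process => msucc Psucc indep Eij.
apply/ae_foralln => m.
have kinj : injective (fun n => ((m + n)%N, i, j)).
  by move=> n n' [] /addnI.
have := @ae_exists_success _ _ _ P _ _ _ _ indep _ (infl i j) kinj.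
move=> /(_ _ _ _ (infl_gt0_le1 Eij)) H.
apply: filterS (H _ _ _) => [w [n wn]|[[s a] b]|//|n].
- by exists (m + n)%N; rewrite leq_addr.
- exact: msucc.
- exact: Psucc.
Qed.

Lemma ae_transmitted (L i : V) (p : dipath E L i) :
  {ae P, forall w, exists t, transmitted success w t p}.
Proof.
elim: p => [|j l q IHq Ejl]; first by apply: aeW => w; exists 0%N.
apply: filterS2 IHq (ae_infinitely_many_successes Ejl).
(* The random time [t] at which [q] is transmitted serves as the bound [m]. The edge is crossed at
   step [s], so its end holds the result from [s.+1] on. *)
move=> w [t tq] /(_ t)[s [ts sw]].
exists s.+1, s; split => //; exact: transmitted_monotone tq.
Qed.

End Transmission.

Theorem theorem3 (R : realType) (V : choiceType) (E : rel V)
    (S : V -> vectType R) (T : forall i j : V, 'Hom(S i, S j))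
    (infl : V -> V -> R)
    (infl_gt0_le1 : forall i j : V, E i j -> 0 < infl i j <= 1)
    (L : V) (XL : S L)
    (d : measure_display) (Omega : measurableType d) (P : probability Omega R)
    (success : nat -> V -> V -> set Omega)
    (influence_process : independent_influence P E infl success) :
  [/\ forall i : V, leadership_component E T XL i ->
        {ae P, forall w : Omega, exists (t : nat) (x : S i),
          [/\ adopts E success T XL w t x,
              consistent E success T XL w x & x != 0]},
      forall i : V, ~ leadership_component E T XL i ->
        forall w : Omega, ~ exists (t : nat) (x : S i),
          [/\ adopts E success T XL w t x,
              consistent E success T XL w x & x != 0] &
      fully_leads E T XL <-> leadership_component E T XL = [set: V]].
Proof.
split.
- move=> i [p]; rewrite memv_ker => Xp.
  apply: filterS (ae_transmitted infl_gt0_le1 influence_process p) => w [t tp].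
  exists t, (interp T p XL); split => //; first by exists p.
  by exists p; split => //; exists t.
(* A nonzero adopted vector comes with a path that itself witnesses membership in the component,
   whatever the outcome. *)
- move=> i iC w [t [x [[p [_ ->]] _ Xp]]].
  by apply: iC; exists p; rewrite memv_ker.
- by split => [full|full i]; [apply/seteqP; split | rewrite full].
Qed.
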